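(* Let $X$ be an approximately ultrahomogeneous (AUH) Banach space, let $Y$ be a subspace of $X$, and let $t\in\mathrm{Emb}(Y,X)$. Then: (1) $t$ extends uniquely to an isometric embedding $\tilde t\in\mathrm{Emb}(\mathrm{Env}(Y),X)$; and $\tilde t(\mathrm{Env}(Y))=\mathrm{Env}(t(Y))$. Assume moreover that $Y$ is separable. Then: (2) the map $t\mapsto\tilde t$ is SOT-SOT continuous (from $\mathrm{Emb}(Y,X)$ to $\mathrm{Emb}(\mathrm{Env}(Y),X)$); (3) $\mathrm{Env}(Y)$ is the maximum (with respect to inclusion) among the subspaces $Y'$ of $X$ containing $Y$ such that any isometric embedding $t:Y\to X$ extends uniquely to an isometric embedding $\tilde t:Y'\to X$, and such that $t\mapsto\tilde t$ is SOT-SOT continuous.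
   Context: $\mathrm{Isom}(X)$ is the group of surjective linear isometries of $X$; $\mathrm{Emb}(Y,X)$ is the set of linear isometric embeddings of $Y$ into $X$. SOT denotes the topology of pointwise norm convergence. $X$ is approximately ultrahomogeneous (AUH) if for every finite-dimensional subspace $F$ of $X$, every $t\in\mathrm{Emb}(F,X)$ and every $\varepsilon>0$ there is $T\in\mathrm{Isom}(X)$ with $\|T|_F-t\|\le\varepsilon$. The isometric envelope $\mathrm{Env}(Y)$ is the set of $x\in X$ such that whenever a net $(T_i)_{i}$ in $\mathrm{Isom}(X)$ satisfies $T_i y\to y$ for every $y\in Y$, then $T_i x\to x$. *)

(* Defs.v *)
From HB Require Import structures.
From mathcomp Require Import all_boot all_order all_algebra.
From mathcomp Require Import all_classical all_reals all_analysis.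

Set Implicit Arguments.
Unset Strict Implicit.
Unset Printing Implicit Defensive.

Import Order.TTheory GRing.Theory Num.Theory.
Import numFieldNormedType.Exports.

Local Open Scope classical_set_scope.
Local Open Scope ring_scope.

(* Banach spaces are taken over an arbitrary [K : numFieldType]; this covers
   the real ([K : realType]) and the complex ([R[i]]) case at once. *)

Section Nets.

Definition directed (I : Type) (le : I -> I -> Prop) : Prop :=
  [/\ inhabited I,
      forall i, le i i,
      forall i j k, le i j -> le j k -> le i k
    & forall i j, exists2 k, le i k & le j k].

(* [(fun i => u i) @ tails le --> l] is convergence of the net [u] to [l]. *)
Definition tails (I : Type) (le : I -> I -> Prop) : set_system I :=
  [set A | exists i0, forall i, le i0 i -> A i].

End Nets.

Section IsometricEmbeddings.
Context {K : numFieldType} {X : completeNormedModType K}.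
Implicit Types Y Z F : set X.

(* Linear subspaces are not required to be topologically closed. *)
Definition linear_subspace Y : Prop := submod_closed [in Y].

Definition finite_dimensional F : Prop :=
  exists (n : nat) (e : 'I_n -> X),
    F = range (fun a : 'I_n -> K => \sum_(i < n) a i *: e i).

Definition separable Y : Prop :=
  exists D : set X, [/\ countable D, D `<=` Y & Y `<=` closure D].

Definition isometry_group : set (X -> X) :=
  [set T | [/\ linear T, forall x, `|T x| = `|x|
             & forall x, exists y, T y = x]].

(* Y is only a set of vectors, so the subtype [Y] has no vector space
   structure; linearity is expressed through the operations of [X]. *)
Definition isometric_embeddings Y : set {ptws Y -> X} :=
  [set t | (forall (a : K) (u v w : Y),
              val w = a *: val u + val v -> t w = a *: t u + t v)
         /\ (forall u : Y, `|t u| = `|val u|)].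
Arguments isometric_embeddings : clear implicits.

(* The last inequality says that the operator norm of T|_F - t is <= eps. *)
Definition approx_ultrahomogeneous : Prop :=
  forall F (t : F -> X) (eps : K),
    finite_dimensional F -> isometric_embeddings F t -> 0 < eps ->
    exists2 T, isometry_group T &
      forall x : F, `|T (val x) - t x| <= eps * `|val x|.

Definition envelope Y : set X :=
  [set x | forall (I : Type) (le : I -> I -> Prop) (T : I -> X -> X),
     directed le -> (forall i, isometry_group (T i)) ->
     (forall y, Y y -> (fun i => T i y) @ tails le --> y) ->
     (fun i => T i x) @ tails le --> x].

Definition extends Y Z (t : Y -> X) (s : Z -> X) : Prop :=
  forall (y : Y) (z : Z), val z = val y -> s z = t y.

Definition isometric_extensions Y Z (t : Y -> X) : set {ptws Z -> X} :=
  [set s | isometric_embeddings Z s /\ extends t s].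
Arguments isometric_extensions {Y} Z t.

(* The map t |-> t~; its value is junk unless an extension exists. *)
Definition extension Y Z (t : {ptws Y -> X}) : {ptws Z -> X} :=
  xget (fun=> 0) (isometric_extensions Z t).

(* The strong operator topology on Emb(Y,X) is the one induced by
   {ptws Y -> X}. *)
Definition SOT_continuous_extension Y Z : Prop :=
  {within isometric_embeddings Y, continuous (@extension Y Z)}.

Definition SOT_extension_space Y Z : Prop :=
  [/\ linear_subspace Z,
      Y `<=` Z,
      forall t : Y -> X, isometric_embeddings Y t ->
        exists! s, isometric_extensions Z t s
    & SOT_continuous_extension Y Z].

End IsometricEmbeddings.
Arguments isometric_embeddings {K X} Y.
Arguments isometric_extensions {K X Y} Z t.
Arguments approx_ultrahomogeneous {K} X.
Arguments extension {K X Y} Z t.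

Section EnvelopeFacts.
Context {K : numFieldType} {X : completeNormedModType K}.
Implicit Types Y : set X.

Lemma tails_filter (I : Type) (le : I -> I -> Prop) :
  directed le -> ProperFilter (tails le).
Proof.
move=> [[i0] lexx le_trans le_ub]; split.
  by move=> [i /(_ i (lexx i))].
split.
- by exists i0.
- move=> A B [i Ai] [j Bj]; have [k ik jk] := le_ub i j; exists k => l kl.
  by split; [apply: Ai; apply: le_trans kl|apply: Bj; apply: le_trans kl].
- by move=> A B AB [i Ai]; exists i => j /Ai /AB.
Qed.

Lemma sub_envelope Y : Y `<=` envelope Y.
Proof. by move=> y Yy I le T _ _; apply. Qed.

Lemma envelope_linear_subspace Y : linear_subspace (envelope Y).
Proof.
split; rewrite ?inE.
  move=> I le T dle isoT _; have pF := tails_filter dle.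
  have -> : (fun i => T i 0) = cst 0.
    by apply/funext => i; have [_ nT _] := isoT i; apply/normr0_eq0;
       rewrite nT normr0.
  exact: cvg_cst.
move=> a u v; rewrite !inE => Eu Ev I le T dle isoT Ty.
have pF := tails_filter dle.
have -> : (fun i => T i (a *: u + v)) = (fun i => a *: T i u + T i v).
  by apply/funext => i; have [lT _ _] := isoT i; rewrite lT.
by apply: cvgD; [apply: cvgZr; apply: Eu|apply: Ev].
Qed.

(* A largest subspace with some property which is an envelope is thus also the
   largest closed subspace with it. *)
Lemma envelope_closed Y : closed (envelope Y).
Proof.
move=> x clx I le T dle isoT Ty; have pF := tails_filter dle.
apply/cvgrPdist_lt => e e0.
have e2 : 0 < e / 2 by rewrite divr_gt0.
have e4 : 0 < e / 2 / 2 by rewrite divr_gt0.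
have [z [Ez]] := clx _ (nbhsx_ballx x _ e4).
rewrite -ball_normE /= => xz.
have := Ez _ _ _ dle isoT Ty => /cvgrPdist_lt/(_ _ e2)[i0 i0P].
exists i0 => i /i0P zi; have [lT nT _] := isoT i.
have Tzx : `|T i z - T i x| = `|x - z|.
  have := nT (z - x); rewrite -(scaleN1r x) addrC lT scaleN1r.
  by rewrite scaleN1r ![- _ + _]addrC (distrC z) => ->.
have -> : x - T i x = (x - z) + (T i z - T i x) + (z - T i z).
  by rewrite addrAC !addrA !subrK.
rewrite (splitr e) {1}(splitr (e / 2)) (le_lt_trans (ler_normD _ _))// ltrD//.
by rewrite (le_lt_trans (ler_normD _ _))// Tzx ltrD.
Qed.

End EnvelopeFacts.

(* Main.v *)
Require Import Defs.
From mathcomp Require Import all_boot all_order all_algebra.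
From mathcomp Require Import all_classical all_reals all_analysis.
Import numFieldNormedType.Exports.
Import Order.TTheory GRing.Theory Num.Theory.
Local Open Scope classical_set_scope.
Local Open Scope ring_scope.

Set Implicit Arguments.
Unset Strict Implicit.
Unset Printing Implicit Defensive.

(** Nets are traded for a modulus.  A vector x lies in the envelope of Y
    exactly when for every d > 0 there are a finite list F of vectors of Y and
    some h > 0 such that any isometry moving each vector of F by at most h moves
    x by at most d (envelope_modulus, modulus_envelope).  Composing with an
    inverse, any two isometries that are h-close on F are then d-close at x.

    Approximate ultrahomogeneity says that an isometric embedding of a subspace
    is, on finite lists, as close as desired to a global isometry
    (embedding_approx).  So the modulus passes from isometries to isometric
    embeddings of Env(Y): if two of them are h-close on F, they are d-close at x
    (envelope_embedding_modulus).  Since F and h depend only on x and d, this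
    single estimate gives both the uniqueness of extensions and the SOT
    continuity of the extension map.

    For existence, given t : Y -> X, the isometries that approximate t on finite
    lists form a filter.  By the modulus its image under evaluation at a point of
    Env(Y) is Cauchy, and the limits define the extension.

    The extension s of t sends Env(Y) into Env(t(Y)): if T is an isometry
    approximating s and R is an isometry almost fixing finitely many vectors of
    t(Y), then R T and T almost agree on the corresponding vectors of Y, hence at
    points of Env(Y) (envelope_image).  The reverse inclusion is
    the same fact for the inverse embedding of t(Y): its extension q maps
    Env(t(Y)) into Env(Y), and s o q, which extends the inclusion of t(Y), is the
    inclusion of Env(t(Y)) by uniqueness (envelope_range_sub).

    Maximality holds because isometries T_i converging to the identity on Y
    restrict to embeddings of Y that converge to the inclusion; the extension of
    each restriction to Y' is the restriction of T_i to Y', so continuity forces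
    T_i to converge to the identity on Y' (SOT_extension_space_sub). *)

(** * Isometries and isometric embeddings *)

Section Isometries.
Context {K : numFieldType} {X : completeNormedModType K}.
Implicit Types (S T : X -> X) (x y : X).

Lemma isometryB T x y : isometry_group T -> T (x - y) = T x - T y.
Proof.
by move=> [lT _ _]; rewrite -[x - y]addrC -scaleN1r lT scaleN1r addrC.
Qed.

Lemma isometry_dist T x y : isometry_group T -> `|T x - T y| = `|x - y|.
Proof. by move=> isoT; rewrite -isometryB//; case: isoT. Qed.

Lemma isometry_comp S T :
  isometry_group S -> isometry_group T -> isometry_group (S \o T).
Proof.
move=> [lS nS sS] [lT nT sT]; split => [a x y|x|x] /=.
- by rewrite lT lS.
- by rewrite nS nT.
- by have [y <-] := sS x; have [z <-] := sT y; exists z.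
Qed.

Lemma isometry_inv T : isometry_group T ->
  exists2 S, isometry_group S & cancel S T.
Proof.
move=> isoT; have [lT nT /choice[S TS]] := isoT.
have injT x y : T x = T y -> x = y.
  move=> /eqP; rewrite -subr_eq0 -isometryB// -normr_eq0 nT normr_eq0 subr_eq0.
  by move/eqP.
exists S => //; split => [a x y|x|x].
- by apply: injT; rewrite lT !TS.
- by rewrite -nT TS.
- by exists (T x); apply: injT; rewrite TS.
Qed.

Lemma isometry_id : isometry_group (@idfun X).
Proof. by split => // x; exists x. Qed.

End Isometries.

Section Embeddings.
Context {K : numFieldType} {X : completeNormedModType K}.
Implicit Types (Y Z : set X) (T : X -> X).

Lemma isometry_embedding Y T :
  isometry_group T -> isometric_embeddings Y (T \o val).
Proof.
by move=> [lT nT _]; split => [a u v w /= ->|u /=]; [rewrite lT | rewrite nT].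
Qed.

Lemma embedding_dist Y (t : Y -> X) u v : linear_subspace Y ->
  isometric_embeddings Y t -> `|t u - t v| = `|val u - val v|.
Proof.
move=> [_ linY] [lt nt].
have Yuv : val u - val v \in Y.
  rewrite -[val u - val v]addrC -scaleN1r; apply: linY; exact: valP.
pose w : Y := exist _ (val u - val v) Yuv.
have -> : t u - t v = t w; last by rewrite nt.
by rewrite (lt (-1) v u w) ?scaleN1r 1?addrC.
Qed.

Lemma linear_subspace_sum Y (I : Type) (r : seq I) (a : I -> K) (e : I -> X) :
  linear_subspace Y -> (forall i, Y (e i)) -> Y (\sum_(i <- r) a i *: e i).
Proof.
move=> [Y0 linY] Ye; elim/big_ind: _.
- by rewrite inE in Y0.
- move=> x y /mem_set Yx /mem_set Yy; apply: set_mem.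
  by rewrite -[x]scale1r; apply: linY.
- move=> i _; apply: set_mem; rewrite -[_ *: _]addr0; apply: linY => //.
  exact: mem_set.
Qed.

Definition inclusion Y Z (YZ : Y `<=` Z) (y : Y) : Z :=
  exist _ (val y) (mem_set (YZ _ (set_valP y))).

Definition close_on (U : eqType) (F : seq U) (h : K) (f g : U -> X) : Prop :=
  forall u, u \in F -> `|f u - g u| <= h.

(** Approximate ultrahomogeneity is applied to the span of the list, which stays
    inside Y.  Its error bound is relative to the norm of the vector, so the
    tolerance has to be scaled down by the norms of the listed vectors. *)
Lemma embedding_approx Y (t : Y -> X) (F : seq Y) (e : K) :
  approx_ultrahomogeneous X -> linear_subspace Y -> isometric_embeddings Y t ->
  0 < e -> exists2 T, isometry_group T & close_on F e (T \o val) t.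
Proof.
move=> X_AUH linY [lt nt] e0.
pose b (i : 'I_(size F)) : X := val (tnth (in_tuple F) i).
pose V : set X := range (fun a : 'I_(size F) -> K => \sum_(i < size F) a i *: b i).
have VY : V `<=` Y.
  move=> _ [a _ <-]; apply: linear_subspace_sum => // i.
  exact: set_valP.
have FV y : y \in F -> V (val y).
  move=> /(nthP y)[i iF <-]; exists (fun j => (j == Ordinal iF)%:R) => //.
  rewrite (bigD1 (Ordinal iF))//= eqxx scale1r big1 ?addr0.
    by rewrite /b (tnth_nth y).
  by move=> j /negPf ->; rewrite scale0r.
(* The summand 1 keeps M positive when every listed vector is zero. *)
pose M := 1 + \sum_(y <- F) `|val y|.
have M0 : 0 < M by rewrite ltr_pwDl// sumr_ge0.
have embV : isometric_embeddings V (t \o inclusion VY).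
  by split => [a u v w uvw|u]; [exact: lt | exact: nt].
have [T isoT Tt] := X_AUH V _ _ (ex_intro _ _ (ex_intro _ b erefl)) embV (divr_gt0 e0 M0).
exists T => // y yF /=.
have := Tt (exist _ (val y) (mem_set (FV _ yF))).
have -> /= : (t \o inclusion VY) (exist _ (val y) (mem_set (FV _ yF))) = t y.
  by congr t; apply: val_inj.
move=> /le_trans; apply; rewrite mulrAC ler_pdivrMr// ler_pM2l//.
rewrite /M (big_rem y)//= addrCA lerDl addr_ge0//.
by rewrite sumr_ge0.
Qed.

Lemma close_on_subset (U : eqType) (F G : seq U) (h h' : K) (f g : U -> X) :
  {subset F <= G} -> h <= h' -> close_on G h f g -> close_on F h' f g.
Proof. by move=> FG hh' fg u /FG /fg /le_trans; apply. Qed.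

Lemma close_on_trans (U : eqType) (F : seq U) (h h' : K) (f g k : U -> X) :
  close_on F h f g -> close_on F h' g k -> close_on F (h + h') f k.
Proof.
move=> fg gk u uF; rewrite -[f u - _](subrKA (g u)).
by rewrite (le_trans (ler_normD _ _))// lerD ?fg ?gk.
Qed.

Lemma close_on_sym (U : eqType) (F : seq U) (h : K) (f g : U -> X) :
  close_on F h f g -> close_on F h g f.
Proof. by move=> fg u /fg; rewrite distrC. Qed.

Lemma near_close_on (I : Type) (U : eqType) (A : set_system I)
    (g : I -> U -> X) (f : U -> X) (F : seq U) (h : K) : Filter A ->
  0 < h -> (forall u, g i u @[i --> A] --> f u) ->
  \forall i \near A, close_on F h f (g i).
Proof.
move=> AF h0 gf; elim: F => [|y F IHF]; first by apply: nearW => i u.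
have /cvgrPdist_le/(_ h h0) := gf y.
apply: filterS2 IHF => i IHF yi u.
by rewrite inE => /orP[/eqP-> //|]; exact: IHF.
Qed.

(** K is only partially ordered (it may be the complex field), but positive
    elements are comparable. *)
Lemma positive_lower_bound (h h' : K) : 0 < h -> 0 < h' ->
  exists k, [/\ 0 < k, k <= h & k <= h'].
Proof.
move=> h0 h'0; have := comparable_leP (real_comparable (gtr0_real h0) (gtr0_real h'0)).
by case=> hh'; [exists h | exists h'; split=> //; exact: ltW].
Qed.

(** * The modulus of an envelope *)

Lemma third_gt0 (d : K) : 0 < d -> 0 < d / 3.
Proof. by move=> d0; rewrite divr_gt0. Qed.

Lemma add_thirds (d : K) : d / 3 + d / 3 + d / 3 = d.
Proof. by rewrite -!mulrDl -mulr2n -mulrSr -[d *+ 3]mulr_natr mulfK. Qed.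

(** If no pair (F, h) worked, choosing for each pair an isometry that violates
    the estimate would give a net, indexed by finite lists increasing and
    tolerances decreasing, which converges to the identity on Y but not at x. *)
Lemma envelope_modulus Y x : envelope Y x -> forall d : K, 0 < d ->
  exists (F : seq Y) (h : K), 0 < h /\
    forall S T, isometry_group S -> isometry_group T ->
      close_on F h (S \o val) (T \o val) -> `|S x - T x| <= d.
Proof.
move=> Ex d d0.
(* Comparing S with T at u amounts to comparing T^-1 S with the identity. *)
suff [F [h [h0 FhP]]] : exists (F : seq Y) (h : K), 0 < h /\
    forall T, isometry_group T -> close_on F h (T \o val) val -> `|T x - x| <= d.
  exists F, h; split => // S T isoS isoT ST.
  have [R isoR TR] := isometry_inv isoT.
  have RE u v : `|R u - v| = `|u - T v|.
    by rewrite -(isometry_dist _ _ isoT) TR.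
  by rewrite -RE; apply: (FhP _ (isometry_comp isoR isoS)) => u /ST /=; rewrite RE.
apply: contrapT => noFh.
have /choice[T TP] : forall i : seq Y * {posnum K}, exists T,
    [/\ isometry_group T, close_on i.1 i.2%:num (T \o val) val &
        ~ `|T x - x| <= d].
  move=> [F h]; apply: contrapT => noT; apply: noFh; exists F, h%:num; split=> //.
  by move=> T isoT Tid; apply: contrapT => nTx; apply: noT; exists T.
pose le (i j : seq Y * {posnum K}) := {subset i.1 <= j.1} /\ j.2%:num <= i.2%:num :> K.
have dle : directed le.
  split=> [|i|i j k [ij ji] [jk kj]|i j].
  - exact: (inhabits ([::], 1%:pos%R)).
  - by split.
  - by split; [move=> u /ij /jk | exact: le_trans ji].
  - have [k [k0 ki kj]] := positive_lower_bound (gt0 i.2) (gt0 j.2).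
    exists (i.1 ++ j.1, PosNum k0); split=> //= u; rewrite mem_cat => ->//.
    by rewrite orbT.
have pF := tails_filter dle.
have : (fun i => T i x) @ tails le --> x.
  apply: Ex => // [i|y Yy]; first by have [] := TP i.
  apply/cvgrPdist_le => e e0.
  exists ([:: exist _ y (mem_set Yy)], PosNum e0) => i [Fi ie].
  have [_ /(_ (exist _ y (mem_set Yy))) Ti _] := TP i.
  by rewrite distrC (le_trans _ ie)// Ti// Fi// inE.
move=> /cvgrPdist_le/(_ d d0)[i iP]; have [_ _] := TP i; apply.
by rewrite distrC; apply: iP; case: dle.
Qed.

Lemma modulus_envelope Y x :
  (forall d : K, 0 < d -> exists (F : seq Y) (h : K), 0 < h /\
    forall T, isometry_group T -> close_on F h (T \o val) val ->
      `|T x - x| <= d) ->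
  envelope Y x.
Proof.
move=> Fh I le T dle isoT Ty; have pF := tails_filter dle.
apply/cvgrPdist_le => d d0; have [F [h [h0 FhP]]] := Fh d d0.
have := near_close_on (f := val) (g := fun i => T i \o val) F pF h0
  (fun y : Y => Ty _ (set_valP y)).
by apply: filterS => i /close_on_sym Ti; rewrite distrC; exact: FhP.
Qed.

End Embeddings.

Section Extension.
Context {K : numFieldType} {X : completeNormedModType K}.
Context (X_AUH : approx_ultrahomogeneous X).
Implicit Types (Y Z : set X) (T : X -> X).

(** * Extension of embeddings to the envelope *)

Definition to_envelope Y : Y -> envelope Y := inclusion (@sub_envelope K X Y).

Lemma extends_envelope Y (t : Y -> X) (s : envelope Y -> X) :
  extends t s -> s \o @to_envelope Y = t.
Proof. by move=> ts; apply/funext => y; exact: ts. Qed.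

(** Both embeddings are replaced by isometries approximating them on F and at x,
    so that the modulus for isometries applies.  The pair (F, h) does not depend
    on the embeddings: the estimate is uniform. *)
Lemma envelope_embedding_modulus Y (x : envelope Y) (d : K) : 0 < d ->
  exists (F : seq Y) (h : K), 0 < h /\
    forall s s' : envelope Y -> X,
      isometric_embeddings (envelope Y) s -> isometric_embeddings (envelope Y) s' ->
      close_on F h (s \o @to_envelope Y) (s' \o @to_envelope Y) ->
      `|s x - s' x| <= d.
Proof.
move=> d0; have d3 := third_gt0 d0.
have [F [h [h0 FhP]]] := envelope_modulus (set_valP x) d3.
have h3 := third_gt0 h0.
exists F, (h / 3); split=> // s s' embs embs' ss'.
have [k [k0 kh kd]] := positive_lower_bound h3 d3.
pose G := x :: map (@to_envelope Y) F.
have linE := @envelope_linear_subspace K X Y.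
have [S isoS Ss] := embedding_approx G X_AUH linE embs k0.
have [T isoT Ts] := embedding_approx G X_AUH linE embs' k0.
have FG y : y \in F -> @to_envelope Y y \in G.
  by move=> yF; rewrite inE map_f ?orbT.
have ST : `|S (val x) - T (val x)| <= d / 3.
  apply: FhP => //; rewrite -[h]add_thirds.
  apply: (close_on_trans (g := s' \o @to_envelope Y)).
    apply: (close_on_trans (g := s \o @to_envelope Y)) => // y /FG yG.
    exact: le_trans (Ss _ yG) kh.
  by apply: close_on_sym => y /FG yG; exact: le_trans (Ts _ yG) kh.
have xG : x \in G by rewrite inE eqxx.
rewrite -[s x - _](subrKA (S (val x))) -[S _ - _](subrKA (T (val x))).
rewrite -[d]add_thirds addrC (le_trans (ler_normD _ _))// lerD//.
  rewrite (le_trans (ler_normD _ _))// lerD//.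
  exact: le_trans (Ts _ xG) kd.
by rewrite distrC; exact: le_trans (Ss _ xG) kd.
Qed.

Lemma envelope_extension_unique Y (t : Y -> X) (s s' : envelope Y -> X) :
  isometric_extensions (envelope Y) t s ->
  isometric_extensions (envelope Y) t s' -> s = s'.
Proof.
move=> [embs /extends_envelope ts] [embs' /extends_envelope ts'].
apply/funext => x; apply/eqP; rewrite -subr_eq0 -normr_le0.
apply/ler_addgt0Pl => d d0; rewrite addr0.
have [F [h [h0 FhP]]] := envelope_embedding_modulus x d0.
by apply: FhP => //; rewrite ts ts' => y _; rewrite subrr normr0 ltW.
Qed.

(** The filter of isometries close to t on ever larger finite lists.  It plays
    the role of a net of isometries converging pointwise to t on Y. *)
Definition approximations Y (t : Y -> X) : set_system (X -> X) :=
  filter_from [set: seq Y * {posnum K}] (fun i =>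
    [set T | isometry_group T /\ close_on i.1 i.2%:num (T \o val) t]).

Lemma approximations_filter Y (t : Y -> X) : linear_subspace Y ->
  isometric_embeddings Y t -> ProperFilter (approximations t).
Proof.
move=> linY embt; apply: filter_from_proper => [|i _]; last first.
  have [T isoT Tt] := embedding_approx i.1 X_AUH linY embt (gt0 i.2).
  by exists T.
apply: filter_from_filter => [|i j _ _]; first by exists ([::], 1%:pos%R).
have [k [k0 ki kj]] := positive_lower_bound (gt0 i.2) (gt0 j.2).
exists (i.1 ++ j.1, PosNum k0) => // T [isoT Tt].
by split; split=> //; apply: close_on_subset Tt => // u;
   rewrite mem_cat => ->//; rewrite orbT.
Qed.

(** Two isometries that approximate t within h/2 on F are h-close on F, hence
    close at x: the images of x form a Cauchy filter, and X is complete. *)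
Lemma approximations_cvg Y (t : Y -> X) x : linear_subspace Y ->
  isometric_embeddings Y t -> envelope Y x ->
  cvg (T x @[T --> approximations t]).
Proof.
move=> linY embt Ex; have pF := approximations_filter linY embt.
apply: cauchy_cvg; apply: cauchy_exP => e e0.
have e2 : 0 < e / 2 by rewrite divr_gt0.
have [F [h [h0 FhP]]] := envelope_modulus Ex e2.
have h2 : 0 < h / 2 by rewrite divr_gt0.
have [S isoS St] := embedding_approx F X_AUH linY embt h2.
exists (S x); exists (F, PosNum h2) => // T [isoT Tt] /=.
rewrite -ball_normE /= (le_lt_trans (FhP _ _ isoS isoT _))//.
  by rewrite [h]splitr; apply: close_on_trans St (close_on_sym Tt).
by rewrite ltr_pdivrMr// ltr_pMr// ltr1n.
Qed.

(** The pointwise limit of the approximating isometries inherits linearity and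
    preservation of the norm from them. *)
Lemma envelope_extension_exists Y (t : Y -> X) : linear_subspace Y ->
  isometric_embeddings Y t -> exists s, isometric_extensions (envelope Y) t s.
Proof.
move=> linY embt; have pF := approximations_filter linY embt.
have isoF : \forall T \near approximations t, isometry_group T.
  by exists ([::], 1%:pos%R) => // T [].
pose s (x : envelope Y) := lim (T (val x) @[T --> approximations t]).
have sP (x : envelope Y) : T (val x) @[T --> approximations t] --> s x.
  exact: approximations_cvg (set_valP x).
exists s; split; last first.
  move=> y x xy; apply: (norm_cvg_unique (sP x)).
  apply/cvgrPdist_le => e e0; exists ([:: y], PosNum e0) => // T [_ Tt] /=.
  by rewrite distrC xy; apply: Tt; rewrite inE.
split=> [a u v w wE|u].
  suff Tw : T (val w) @[T --> approximations t] --> a *: s u + s v.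
    exact: norm_cvg_unique (sP w) Tw.
  apply: (cvg_trans _ (cvgD (cvgZl_tmp (k := a) (sP u)) (sP v))).
  apply: near_eq_cvg => /=.
  by apply: filterS isoF => T [lT _ _]; rewrite wE lT.
apply: (@norm_cvg_unique _ K^o _ _ _ _ (cvg_norm (sP u))).
apply: cvg_near_cst.
by apply: filterS isoF => T [_ nT _] /=; rewrite nT.
Qed.

(** * The image of the envelope *)

(** Let T be an isometry approximating s on F and at x.  If R almost fixes t(F),
    then R T and T are close on F, hence at x; since T x is close to s x, it
    follows that R almost fixes s x. *)
Lemma envelope_image Y (t : Y -> X) (s : envelope Y -> X) x :
  isometric_extensions (envelope Y) t s -> envelope (range t) (s x).
Proof.
move=> [embs /extends_envelope st]; apply: modulus_envelope => d d0.
have d3 := third_gt0 d0.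
have [F [h [h0 FhP]]] := envelope_modulus (set_valP x) d3.
have h3 := third_gt0 h0.
have [k [k0 kh kd]] := positive_lower_bound h3 d3.
pose im (y : Y) : range t := exist _ (t y) (mem_set (imageT t y)).
exists (map im F), (h / 3); split=> // R isoR Rid.
have linE := @envelope_linear_subspace K X Y.
have [T isoT Ts] :=
  embedding_approx (x :: map (@to_envelope Y) F) X_AUH linE embs k0.
have Tsx : `|T (val x) - s x| <= k := Ts x (mem_head _ _).
have Tt : close_on F k (T \o val : Y -> X) t.
  by rewrite -st => y yF; apply: (Ts (@to_envelope Y y)); rewrite inE map_f ?orbT.
have RTx : `|R (T (val x)) - T (val x)| <= d / 3.
  apply: (FhP (R \o T)) => //; first exact: isometry_comp.
  rewrite -[h]add_thirds.
  apply: (close_on_trans (g := t)).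
    apply: (close_on_trans (g := R \o t)) => y yF /=; last first.
      by apply: (Rid (im y)); rewrite map_f.
    by rewrite isometry_dist//; exact: le_trans (Tt _ yF) kh.
  by apply: close_on_sym => y /Tt /le_trans; apply.
rewrite -[R _ - _](subrKA (R (T (val x)))) -[R (T _) - _](subrKA (T (val x))).
rewrite -[d]add_thirds addrC (le_trans (ler_normD _ _))// lerD//.
  by rewrite (le_trans (ler_normD _ _))// lerD// (le_trans Tsx).
by rewrite isometry_dist// distrC (le_trans Tsx).
Qed.

Lemma range_linear_subspace Y (t : Y -> X) :
  linear_subspace Y -> isometric_embeddings Y t -> linear_subspace (range t).
Proof.
move=> [Y0 linY] [lt nt]; split.
  apply/mem_set; exists (exist _ 0 Y0) => //.
  by apply/eqP; rewrite -normr_eq0 nt normr0.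
move=> a _ _ /set_mem[u _ <-] /set_mem[v _ <-]; apply/mem_set.
pose w : Y := exist _ (a *: val u + val v) (linY _ _ _ (valP u) (valP v)).
by exists w => //; exact: lt.
Qed.

Lemma embedding_inverse Y (t : Y -> X) :
  linear_subspace Y -> isometric_embeddings Y t ->
  exists2 r : range t -> Y, isometric_embeddings (range t) (val \o r) &
    forall z, t (r z) = val z.
Proof.
move=> linY embt; have [lt nt] := embt; have [_ linY'] := linY.
have /choice[r tr] : forall z : range t, exists y, t y = val z.
  by move=> z; have [y _ ty] := set_valP z; exists y.
exists r => //; split=> [a u v w wE|u] /=; last by rewrite -tr nt.
pose y : Y := exist _ (a *: val (r u) + val (r v))
  (linY' _ _ _ (valP (r u)) (valP (r v))).
apply/eqP; rewrite -subr_eq0 -normr_eq0 -[a *: _ + _]/(val y).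
by rewrite -(embedding_dist _ y linY embt) (lt a (r u) (r v) y)// !tr wE subrr normr0.
Qed.

(** A preimage of z under s is q z, where q extends the inverse embedding of t
    to Env(t(Y)): the map s o q extends the inclusion of t(Y), as does the
    inclusion of Env(t(Y)), so uniqueness identifies the two. *)
Lemma envelope_range_sub Y (t : Y -> X) (s : envelope Y -> X) :
  linear_subspace Y -> isometric_embeddings Y t ->
  isometric_extensions (envelope Y) t s -> envelope (range t) `<=` range s.
Proof.
move=> linY embt [[ls ns] st] z Ez.
have [r embr tr] := embedding_inverse linY embt.
have linR := range_linear_subspace linY embt.
have [q qP] := envelope_extension_exists linR embr.
have qE w : envelope Y (q w).
  have := envelope_image (x := w) qP; suff -> : range (val \o r) = Y by [].
  apply/seteqP; split=> [_ [v _ <-]|y Yy]; first exact: set_valP.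
  pose y' : Y := exist _ y (mem_set Yy).
  pose v : range t := exist _ (t y') (mem_set (imageT t y')).
  exists v => //=; apply/eqP; rewrite -subr_eq0 -normr_eq0.
  by rewrite -(embedding_dist (r v) y' linY embt) tr /= subrr normr0.
pose sq (w : envelope (range t)) := s (exist _ (q w) (mem_set (qE w))).
suff -> : z = sq (exist _ z (mem_set Ez)) by [].
suff -> : sq = val by [].
have [[lq nq] rq] := qP.
apply: (@envelope_extension_unique _ (fun w : range t => val w)).
  split; first by split=> [a u v w wE|u]; [apply: ls; exact: lq | rewrite /sq ns; exact: nq].
  move=> y w wy; rewrite -tr; apply: st => /=; exact: rq.
split; last by move=> y w ->.
by split.
Qed.

Lemma extensionP Y (t : Y -> X) : linear_subspace Y ->
  isometric_embeddings Y t ->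
  isometric_extensions (envelope Y) t (extension (envelope Y) t).
Proof. by move=> linY embt; apply: xgetPex; exact: envelope_extension_exists. Qed.

Lemma range_extension Y (t : Y -> X) : linear_subspace Y ->
  isometric_embeddings Y t ->
  range (extension (envelope Y) t) = envelope (range t).
Proof.
move=> linY embt; have ext := extensionP linY embt; apply/seteqP; split.
  by move=> _ [x _ <-]; exact: envelope_image ext.
exact: envelope_range_sub ext.
Qed.

(** * Continuity of the extension map and maximality *)

Lemma ptws_cvgP (I : Type) (U : eqType) (F : set_system I) (g : I -> U -> X)
    (f : U -> X) : Filter F ->
  g @ F --> (f : {ptws U -> X}) <-> forall u, g i u @[i --> F] --> f u.
Proof.
move=> FF; split=> [gf u|gf].
  exact: (cvg_comp _ _ gf (@proj_continuous U (fun=> X) u f)).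
apply/cvg_sup => u; apply/cvg_image; first by rewrite eqEsubset; split=> v // _; exists (cst v).
move=> A /gf /= FA; exists (@^~ u @^-1` A) => //.
by rewrite eqEsubset; split => [_ [h ? <-//]|v Av]; exists (fun=> v).
Qed.

(** The pair (F, h) given by the modulus at x defines an SOT neighbourhood of t,
    on which the extensions vary by at most d at x. *)
Lemma extension_SOT_continuous Y : linear_subspace Y ->
  SOT_continuous_extension Y (envelope Y).
Proof.
move=> linY; apply/subspace_continuousP => t embt.
apply/ptws_cvgP => x; apply/cvgrPdist_le => d d0.
have [F [h [h0 FhP]]] := envelope_embedding_modulus x d0.
have extE (t' : Y -> X) : isometric_embeddings Y t' ->
    extension (envelope Y) t' \o @to_envelope Y = t'.
  by move=> embt'; apply: extends_envelope; case: (extensionP linY embt').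
suff tt' : \forall t' \near within (isometric_embeddings Y) (nbhs (t : {ptws Y -> X})),
    isometric_embeddings Y t' /\ close_on F h t t'.
  apply: filterS tt' => t' [embt' tt']; apply: FhP; rewrite ?extE//.
    by case: (extensionP linY embt).
  by case: (extensionP linY embt').
apply: filterI; first exact: withinT.
have cvgt (y : Y) :
    id t' y @[t' --> within (isometric_embeddings Y) (nbhs (t : {ptws Y -> X}))] -->
      t y.
  move: y; apply: (ptws_cvgP id t _).1.
  exact: (@cvg_within _ (nbhs t) _ (isometric_embeddings Y)).
exact: near_close_on h0 cvgt.
Qed.

(** An isometry S restricted to Z is the extension to Z of its restriction to Y,
    so a net of isometries converging on Y is carried by the continuous extension
    map to the same net on Z. *)
Lemma SOT_extension_space_sub Y Z :
  SOT_extension_space Y Z -> Z `<=` envelope Y.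
Proof.
move=> [linZ YZ extZ contZ] x Zx I le T dle isoT Ty.
have pF := tails_filter dle.
have extE S : isometry_group S -> extension Z (S \o val : Y -> X) = S \o val.
  move=> isoS; have embS := isometry_embedding Y isoS.
  have [s [_ sU]] := extZ _ embS.
  have Sext : isometric_extensions Z (S \o val : Y -> X) (S \o val).
    by split; [exact: isometry_embedding | move=> y z /= ->].
  rewrite -(sU _ Sext); apply/esym/sU; exact: xgetI Sext.
have id_iso := @isometry_id K X.
have /subspace_continuousP contZ' := contZ.
have Tcvg : (fun i => T i \o val : Y -> X) @ tails le -->
    within (isometric_embeddings Y) (nbhs (idfun \o val : {ptws Y -> X})).
  move=> A wA.
  have Tid : (fun i => T i \o val : Y -> X) @ tails le -->
      (idfun \o val : {ptws Y -> X}).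
    by apply/ptws_cvgP => y; exact: Ty (set_valP y).
  by apply: (filterS (F := tails le) _ (Tid _ wA)) => i; apply; exact: isometry_embedding (isoT i).
have extT : (fun i => extension Z (T i \o val : Y -> X)) @ tails le -->
    extension Z (idfun \o val : Y -> X).
  exact: cvg_comp Tcvg (contZ' _ (isometry_embedding Y id_iso)).
move/ptws_cvgP/(_ (exist _ x (mem_set Zx))): extT; rewrite (extE _ id_iso) /=.
by under eq_fun do rewrite (extE _ (isoT _)).
Qed.

End Extension.

Theorem proposition2p38 (K : numFieldType) (X : completeNormedModType K)
    (X_AUH : approx_ultrahomogeneous X)
    (Y : set X) (Y_subspace : linear_subspace Y) :
  (forall t : Y -> X, isometric_embeddings Y t ->
     (exists! s, isometric_extensions (envelope Y) t s) /\
     range (extension (envelope Y) t) = envelope (range t)) /\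
  (separable Y ->
     SOT_continuous_extension Y (envelope Y) /\
     (SOT_extension_space Y (envelope Y) /\
      forall Y' : set X, SOT_extension_space Y Y' -> Y' `<=` envelope Y)).
Proof.
have extU t : isometric_embeddings Y t ->
    exists! s, isometric_extensions (envelope Y) t s.
  move=> embt; have [s sP] := envelope_extension_exists X_AUH Y_subspace embt.
  by exists s; split=> // s' s'P; exact: envelope_extension_unique sP s'P.
split=> [t embt|_]; first by split; [exact: extU | exact: range_extension].
have contE := extension_SOT_continuous X_AUH Y_subspace.
split=> //; split; last by move=> Y'; exact: SOT_extension_space_sub.
split=> //; [exact: envelope_linear_subspace | exact: sub_envelope].
Qed.
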